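(* Let $\hat m,\hat n\in S^2$ with $\hat m^{\mathrm T}\hat n\in[0,1)$, and put $\delta=\arccos\hat m^{\mathrm T}\hat n\in(0,\pi/2]$ and $\hat l=\|\hat m\times\hat n\|^{-1}\,\hat m\times\hat n$. Let $U\in\mathrm{SU}(2)$, and let $\alpha',\gamma'\in\mathbb R$, $\beta'\in[0,\pi]$ be such that $R_{\hat l}(-\delta)U=R_{\hat m}(\alpha')R_{\hat l}(\beta')R_{\hat m}(\gamma')$. Let $k'\in\mathbb N$ and $\beta'_1,\dots,\beta'_{k'}\in(0,2\delta]$ satisfy $\beta'+\delta=\beta'_1+\cdots+\beta'_{k'}$. Let $t_1,\dots,t_{k'}\in\mathbb R$ be arbitrary and, for $j=1,\dots,k'$, put $$\alpha'_j=H_{t_j}(\beta'_j,\delta)-\frac\pi2,\qquad \gamma'_j=H_{t_j}(\beta'_j,\delta)+\frac\pi2,\qquad \theta'_j=2\arcsin\frac{\sin(\beta'_j/2)}{\sin\delta}.$$ Then $$R_{\hat l}(\beta'_j)=R_{\hat m}(-\alpha'_j)R_{\hat n}(\theta'_j)R_{\hat m}(-\gamma'_j)\qquad (j=1,\dots,k'),$$ and $$U=R_{\hat n}(\alpha')\,R_{\hat m}(-\alpha'_1)R_{\hat n}(\theta'_1)\,R_{\hat m}(-\gamma'_1-\alpha'_2)R_{\hat n}(\theta'_2)\cdots R_{\hat m}(-\gamma'_{k'-1}-\alpha'_{k'})R_{\hat n}(\theta'_{k'})\,R_{\hat m}(-\gamma'_{k'}+\gamma').$$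
   Context: $\mathbb N$ is the set of strictly positive integers; $S^2=\{\hat v\in\mathbb R^3:\|\hat v\|=1\}$; $\arccos$ takes values in $[0,\pi]$ and $\arcsin$ in $[-\pi/2,\pi/2]$. $I$ is the $2\times2$ identity matrix and $X=\begin{pmatrix}0&1\\1&0\end{pmatrix}$, $Y=\begin{pmatrix}0&-i\\i&0\end{pmatrix}$, $Z=\begin{pmatrix}1&0\\0&-1\end{pmatrix}$. For $\hat v=(v_x,v_y,v_z)^{\mathrm T}\in S^2$ and $\theta\in\mathbb R$, $$R_{\hat v}(\theta)=(\cos\tfrac\theta2)I-i(\sin\tfrac\theta2)(v_xX+v_yY+v_zZ)\in \mathrm{SU}(2).$$ For real $\beta,\delta$ with $0\le\beta/2\le\delta\le\pi/2$, $\delta\ne0$, and $t\in\mathbb R$: $H_t(\beta,\delta)=0$ if $\beta/2<\delta=\pi/2$; $H_t(\beta,\delta)=t$ if $\beta/2=\delta=\pi/2$; and $H_t(\beta,\delta)=\arcsin\frac{\tan(\beta/2)}{\tan\delta}$ otherwise. *)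

(* Defs.v *)
From mathcomp Require Import all_boot all_order all_algebra.
From mathcomp Require Import complex.
From mathcomp Require Import all_classical all_reals all_analysis.

Set Implicit Arguments.
Unset Strict Implicit.
Unset Printing Implicit Defensive.

Import Order.TTheory GRing.Theory Num.Theory.

Local Open Scope ring_scope.

Definition dotp (R : realType) (u v : 'cV[R]_3) : R := (u^T *m v) 0 0.

(* The Euclidean norm; the library norm on 'cV[R]_3 is the sup norm. *)
Definition norm2 (R : realType) (v : 'cV[R]_3) : R := Num.sqrt (dotp v v).

Definition sphere2 (R : realType) : set 'cV[R]_3 :=
  [set v | norm2 v = 1]%classic.

(* Coordinates x, y, z have indices 0, 1, 2 (as elements of 'I_3). *)
Definition crossp (R : realType) (u v : 'cV[R]_3) : 'cV[R]_3 :=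
  \col_(i < 3) [:: u 1 0 * v 2 0 - u 2 0 * v 1 0;
                   u 2 0 * v 0 0 - u 0 0 * v 2 0;
                   u 0 0 * v 1 0 - u 1 0 * v 0 0]`_i.

Definition mx2 (T : nzRingType) (a b c d : T) : 'M[T]_2 :=
  \matrix_(i < 2, j < 2) (nth [::] [:: [:: a; b]; [:: c; d]] i)`_j.

Definition pauliX (R : realType) : 'M[R[i]]_2 := mx2 0 1 1 0.
Definition pauliY (R : realType) : 'M[R[i]]_2 := mx2 0 (- 'i%C) 'i%C 0.
Definition pauliZ (R : realType) : 'M[R[i]]_2 := mx2 1 0 0 (- 1).

Definition SU2 (R : realType) : set 'M[R[i]]_2 :=
  [set U | U \is unitarymx /\ \det U = 1]%classic.

Definition rotSU2 (R : realType) (v : 'cV[R]_3) (theta : R) : 'M[R[i]]_2 :=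
  (cos (theta / 2))%:C%C *: 1%:M
  - ('i%C * (sin (theta / 2))%:C%C) *:
      ((v 0 0)%:C%C *: pauliX R + (v 1 0)%:C%C *: pauliY R
       + (v 2 0)%:C%C *: pauliZ R).

(* Meaningful for 0 <= beta / 2 <= delta <= pi / 2 and delta != 0; the values
   outside this domain are irrelevant. *)
Definition Hfun (R : realType) (t beta delta : R) : R :=
  if (beta / 2 < delta) && (delta == pi / 2) then 0
  else if (beta / 2 == delta) && (delta == pi / 2) then t
  else asin (tan (beta / 2) / tan delta).

(* Main.v *)
(* SU(2) is the group of unit quaternions: [rotSU2 v theta] is the quaternion
   with real part cos(theta/2) and vector part sin(theta/2) v.  Put
   e = (n - cos delta m) / sin delta, so that (m, e, l) is a right-handed
   orthonormal frame and n = cos delta m + sin delta e.  A rotation about l by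
   delta takes m to n, whence R_l(delta) R_m(a) = R_n(a) R_l(delta) and
   U = R_n(alpha') R_l(beta' + delta) R_m(gamma'); the angle beta' + delta is
   then split into the beta'_j.  Multiplying R_n(theta) by rotations about m
   turns its (1, m) part by the half-sum of the two angles and its (e, l) part
   by their half-difference, which here is pi/2 and sends e to l. *)
Require Import Defs.
From mathcomp Require Import all_boot all_order all_algebra.
From mathcomp Require Import complex ring lra.
From mathcomp Require Import all_classical all_reals all_analysis.

Import Order.TTheory GRing.Theory Num.Theory.

Local Open Scope ring_scope.

(** * Cross products, and quaternions as complex 2 by 2 matrices *)

Section Quaternions.
Context {R : realType}.
Implicit Types (u v w : 'cV[R]_3) (a b x y z : R).

Lemma ord3_ind (P : 'I_3 -> Prop) : P 0 -> P 1 -> P 2 -> forall i, P i.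
Proof.
move=> P0 P1 P2 [[|[|[|i]]] lt_i3] //.
- by rewrite (_ : Ordinal lt_i3 = 0) //; apply: val_inj.
- by rewrite (_ : Ordinal lt_i3 = 1) //; apply: val_inj.
- by rewrite (_ : Ordinal lt_i3 = 2) //; apply: val_inj.
Qed.

Lemma eq_cV3 u v :
  u 0 0 = v 0 0 -> u 1 0 = v 1 0 -> u 2 0 = v 2 0 -> u = v.
Proof.
by move=> e0 e1 e2; apply/colP; apply: ord3_ind.
Qed.

Lemma dotpE u v : dotp u v = u 0 0 * v 0 0 + u 1 0 * v 1 0 + u 2 0 * v 2 0.
Proof.
rewrite /dotp mxE !big_ord_recl big_ord0 !mxE addr0 addrA.
by congr (_ + u _ _ * v _ _ + u _ _ * v _ _); apply: val_inj.
Qed.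

Lemma crosspE u v :
  (crossp u v 0 0 = u 1 0 * v 2 0 - u 2 0 * v 1 0)
  * (crossp u v 1 0 = u 2 0 * v 0 0 - u 0 0 * v 2 0)
  * (crossp u v 2 0 = u 0 0 * v 1 0 - u 1 0 * v 0 0).
Proof. by rewrite !mxE. Qed.

Lemma lagrange_identity u v :
  dotp (crossp u v) (crossp u v) = dotp u u * dotp v v - dotp u v ^+ 2.
Proof. rewrite !dotpE !crosspE; ring. Qed.

Lemma crossp_triple u v w : crossp u (crossp v w) = dotp u w *: v - dotp u v *: w.
Proof. by apply: eq_cV3; rewrite !crosspE !mxE !dotpE; ring. Qed.

Lemma crossp_comb u v w x y z x' y' z' :
  crossp (x *: u + y *: v + z *: w) (x' *: u + y' *: v + z' *: w)
  = (x * y' - y * x') *: crossp u v + (x * z' - z * x') *: crossp u w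
    + (y * z' - z * y') *: crossp v w.
Proof. by apply: eq_cV3; rewrite !mxE /= ?mxE; ring. Qed.

Lemma sphere2P v : sphere2 v <-> dotp v v = 1.
Proof.
rewrite /sphere2 /norm2 /=; split=> [|->]; last by rewrite sqrtr1.
move=> /(congr1 (fun x => x ^+ 2)); rewrite sqr_sqrtr ?expr1n //.
by rewrite dotpE -!expr2 !addr_ge0 ?sqr_ge0.
Qed.

(* [a - i (v_x X + v_y Y + v_z Z)] *)
Definition quat a v : 'M[R[i]]_2 :=
  mx2 (a -i* v 2 0)%C (- v 1 0 -i* v 0 0)%C
      (v 1 0 -i* v 0 0)%C (a +i* v 2 0)%C.

Lemma ord2_ind (P : 'I_2 -> Prop) : P 0 -> P 1 -> forall i, P i.
Proof.
move=> P0 P1 [[|[|i]] lt_i2] //.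
- by rewrite (_ : Ordinal lt_i2 = 0) //; apply: val_inj.
- by rewrite (_ : Ordinal lt_i2 = 1) //; apply: val_inj.
Qed.

(** This is Hamilton's product: -iX, -iY, -iZ multiply like the quaternion units i, j, k. *)
Lemma quat_mul a b u v :
  quat a u *m quat b v
  = quat (a * b - dotp u v) (a *: v + b *: u + crossp u v).
Proof.
apply/matrixP; elim/ord2_ind; elim/ord2_ind;
rewrite !mxE !big_ord_recl big_ord0 !mxE /= ?dotpE; simpc;
by congr (_ +i* _)%C; ring.
Qed.

Lemma rotSU2E v theta :
  rotSU2 v theta = quat (cos (theta / 2)) (sin (theta / 2) *: v).
Proof.
apply/matrixP; elim/ord2_ind; elim/ord2_ind;
rewrite !mxE /=; simpc; rewrite ?mulr1n ?mulr0n; simpc;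
by congr (_ +i* _)%C; ring.
Qed.

(** Parallel vectors have zero cross product, so only the addition formulas for cos and sin remain;
    unit length makes the dot product contribute exactly the sin-sin term. *)
Lemma rotSU2D v a b : dotp v v = 1 ->
  rotSU2 v (a + b) = rotSU2 v a *m rotSU2 v b.
Proof.
move=> v1; rewrite !rotSU2E quat_mul mulrDl cosD sinD.
congr quat; first by rewrite -[in LHS](mulr1 (sin (a / 2) * _)) -v1 !dotpE !mxE; ring.
by apply: eq_cV3; rewrite !mxE /= ?mxE; ring.
Qed.

Lemma rotSU20 v : rotSU2 v 0 = 1%:M.
Proof. by rewrite /rotSU2 mul0r cos0 sin0 mulr0 scale0r subr0 scale1r. Qed.

(** Quaternion coordinates along (1, m, e, l), where the third axis l is built in as the cross
    product of [m] and [e]. *)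
Definition fquat m e a x y z := quat a (x *: m + y *: e + z *: crossp m e).

(** A right-handed orthonormal frame multiplies like i, j, k, so identities between rotations reduce
    to polynomial identities in coordinates. *)
Lemma fquat_mul m e a x y z a' x' y' z' :
  dotp m m = 1 -> dotp e e = 1 -> dotp m e = 0 ->
  fquat m e a x y z *m fquat m e a' x' y' z'
  = fquat m e (a * a' - x * x' - y * y' - z * z')
              (a * x' + x * a' + y * z' - z * y')
              (a * y' - x * z' + y * a' + z * x')
              (a * z' + x * y' - y * x' + z * a').
Proof.
move=> mm ee me.
set l := crossp m e.
have ll : dotp l l = 1 by rewrite lagrange_identity mm ee me; ring.
have ml : dotp m l = 0 by rewrite dotpE !crosspE; ring.
have el : dotp e l = 0 by rewrite dotpE !crosspE; ring.
have cme : crossp m l = - e.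
  by rewrite crossp_triple mm me scale0r scale1r sub0r.
have cel : crossp e l = m.
  rewrite crossp_triple ee (_ : dotp e m = 0) ?scale0r ?scale1r ?subr0 //.
  by rewrite -me !dotpE; ring.
rewrite /fquat quat_mul; congr quat.
  transitivity (a * a' - x * x' * dotp m m - y * y' * dotp e e
    - z * z' * dotp l l - (x * y' + y * x') * dotp m e
    - (x * z' + z * x') * dotp m l - (y * z' + z * y') * dotp e l).
    by rewrite !dotpE !mxE; ring.
  by rewrite mm ee ll me ml el; ring.
transitivity (a *: (x' *: m + y' *: e + z' *: l) + a' *: (x *: m + y *: e + z *: l)
  + (x * y' - y * x') *: l + (x * z' - z * x') *: crossp m l
  + (y * z' - z * y') *: crossp e l).
  by rewrite crossp_comb !addrA.
by rewrite cme cel; apply: eq_cV3; rewrite !mxE; ring.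
Qed.

End Quaternions.

(** The left-hand sides are the e, m and real coordinates of R_n(theta). [H] is a polar angle of the
    pair (real, m), whose modulus is cos(beta/2). *)
Lemma Hfun_trig (R : realType) (t beta delta : R) :
  0 < sin delta -> 0 < delta <= pi / 2 -> 0 < beta <= 2 * delta ->
  let H := Hfun t beta delta in
  let theta := 2 * asin (sin (beta / 2) / sin delta) in
  [/\ sin (theta / 2) * sin delta = sin (beta / 2),
      sin (theta / 2) * cos delta = cos (beta / 2) * sin H
    & cos (theta / 2) = cos (beta / 2) * cos H].
Proof.
move=> sin_delta delta_le /andP[beta_gt0 beta_le] H theta.
set b := beta / 2; have b_gt0 : 0 < b by rewrite divr_gt0.
have b_le : b <= delta by rewrite /b; lra.
have [delta_gt0 delta_le2] := andP delta_le.
have sb_ge0 : 0 <= sin b by apply: sin_ge0_pi; apply/andP; split; lra.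
have cb_ge0 : 0 <= cos b by apply: cos_ge0_pihalf; apply/andP; split; lra.
have cd_ge0 : 0 <= cos delta by apply: cos_ge0_pihalf; apply/andP; split; lra.
(* Once both cosines are positive this says tan b <= tan delta, which keeps the argument of [asin]
   in [Hfun] at most 1. *)
have sdb : 0 <= sin delta * cos b - cos delta * sin b.
  by rewrite -sinB; apply: sin_ge0_pi; apply/andP; split; lra.
have sb_le : sin b <= sin delta.
  by rewrite leNgt ltr_sin -?leNgt // in_itv /=; apply/andP; split; lra.
set r := sin b / sin delta.
have rE : r * sin delta = sin b by rewrite /r divfK // gt_eqF.
have r_ge0 : 0 <= r by rewrite divr_ge0 // ltW.
have r_le1 : r <= 1 by rewrite ler_pdivrMr // mul1r.
have thetaE : theta / 2 = asin r by rewrite /theta mulrC mulKf.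
have r_itv : -1 <= r <= 1 by apply/andP; split; lra.
clearbody r; rewrite thetaE asinK ?in_itv //= cos_asin //.
(* The cosine identity follows from the other two by comparing squares; the sign of cos b cos H
   settles the root. *)
suff [eqs cH] : r * cos delta = cos b * sin H /\ 0 <= cos b * cos H.
  split=> //; rewrite -[RHS]ger0_norm // -sqrtr_sqr exprMn.
  congr (Num.sqrt _).
  rewrite [cos H ^+ 2]cos2sin2 mulrBr mulr1 -exprMn -eqs.
  by rewrite [cos b ^+ 2]cos2sin2 -rE !exprMn (sin2cos2 delta); ring.
rewrite /H /Hfun -/b.
(* At delta = pi/2 the left side is 0, and so is the right: either H = 0, or b = pi/2 and cos b = 0
   whatever [t] is. *)
have [dE|d_neq] := eqVneq delta (pi / 2).
  rewrite dE cos_pihalf mulr0 !andbT.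
  have [b_lt|b_ge] := ltP b (pi / 2); first by rewrite sin0 cos0 mulr0 mulr1.
  have -> : b = pi / 2 by apply/eqP; rewrite eq_le b_ge -dE b_le.
  by rewrite eqxx cos_pihalf !mul0r.
rewrite !andbF.
have d_lt : delta < pi / 2 by rewrite lt_neqAle d_neq.
have cb_gt0 : 0 < cos b by apply: cos_gt0_pihalf; apply/andP; split; lra.
have cd_gt0 : 0 < cos delta by apply: cos_gt0_pihalf; apply/andP; split; lra.
set q := tan b / tan delta.
have qE : q = (cos delta * sin b) / (sin delta * cos b).
  by rewrite /q /tan; field; rewrite !gt_eqF.
have q_ge0 : 0 <= q by rewrite qE divr_ge0 ?mulr_ge0 // ltW.
have q_le1 : q <= 1 by rewrite qE ler_pdivrMr ?mulr_gt0 // mul1r -subr_ge0.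
have q_itv : -1 <= q <= 1 by apply/andP; split; lra.
rewrite asinK ?in_itv //= cos_asin //; split.
  by rewrite qE -rE; field; rewrite !gt_eqF.
by rewrite mulr_ge0 ?sqrtr_ge0.
Qed.

(** * Rotations about m, n and l in the frame (m, e, l) *)

Section Frame.
Context {R : realType}.
Variables (m n : 'cV[R]_3) (delta : R).
Hypotheses (mm : dotp m m = 1) (nn : dotp n n = 1) (mn : dotp m n = cos delta).
Hypothesis (sin_delta : 0 < sin delta).

Let l := (norm2 (crossp m n))^-1 *: crossp m n.
Let e := (sin delta)^-1 *: (n - cos delta *: m).

Let sd0 : sin delta != 0. Proof. by rewrite gt_eqF. Qed.

(** The m-component of [n] drops out of the cross product, whose length is sin delta by Lagrange's
    identity. *)
Lemma frame_l : l = crossp m e.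
Proof.
rewrite /l /norm2 lagrange_identity mm nn mn mulr1.
rewrite -(cos2Dsin2 delta) addrC addKr sqrtr_sqr gtr0_norm //.
by apply: eq_cV3; rewrite !mxE /= ?mxE /=; ring.
Qed.

Lemma frame_me : dotp m e = 0.
Proof.
transitivity ((sin delta)^-1 * (dotp m n - cos delta * dotp m m)).
  by rewrite !dotpE !mxE; ring.
by rewrite mm mn; ring.
Qed.

Lemma frame_ee : dotp e e = 1.
Proof.
transitivity ((sin delta)^-2 * (dotp n n - 2 * cos delta * dotp m n
                                + cos delta ^+ 2 * dotp m m)).
  by rewrite !dotpE !mxE -exprVn; ring.
rewrite mm nn mn.
have -> : 1 - 2 * cos delta * cos delta + cos delta ^+ 2 * 1 = sin delta ^+ 2
  by rewrite sin2cos2; ring.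
by rewrite mulVf // expf_neq0.
Qed.

Lemma frame_n : n = cos delta *: m + sin delta *: e.
Proof. by rewrite /e scalerA divff // scale1r addrC subrK. Qed.

Lemma rot_m theta :
  rotSU2 m theta = fquat m e (cos (theta / 2)) (sin (theta / 2)) 0 0.
Proof. by rewrite rotSU2E /fquat !scale0r !addr0. Qed.

Lemma rot_l theta :
  rotSU2 l theta = fquat m e (cos (theta / 2)) 0 0 (sin (theta / 2)).
Proof. by rewrite rotSU2E /fquat !scale0r !add0r frame_l. Qed.

Lemma rot_n theta :
  rotSU2 n theta = fquat m e (cos (theta / 2)) (sin (theta / 2) * cos delta)
    (sin (theta / 2) * sin delta) 0.
Proof.
by rewrite rotSU2E /fquat scale0r addr0 {1}frame_n scalerDr !scalerA.
Qed.

Lemma dotp_ll : dotp l l = 1.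
Proof. by rewrite frame_l lagrange_identity mm frame_ee frame_me; ring. Qed.

Lemma rot_l_conj alpha :
  rotSU2 l delta *m rotSU2 m alpha = rotSU2 n alpha *m rotSU2 l delta.
Proof.
rewrite rot_m rot_n rot_l !fquat_mul ?frame_ee ?frame_me //.
(* R_l(delta) involves delta/2 while n involves delta; double-angle formulas leave a polynomial
   identity modulo s^2 + c^2 = 1. *)
have -> : cos delta = cos (delta / 2) ^+ 2 - sin (delta / 2) ^+ 2.
  by rewrite {1}[delta]splitr cosD.
have -> : sin delta = 2 * sin (delta / 2) * cos (delta / 2).
  by rewrite {1}[delta]splitr sinD; ring.
set s := sin (delta / 2); set c := cos (delta / 2).
have h : s ^+ 2 = 1 - c ^+ 2 by exact: sin2cos2.
by congr fquat; ring: h.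
Qed.

(** m commutes with 1 and m but anticommutes with e and l, so on the (e, l) plane a right factor
    acts like its inverse on the left. *)
Lemma rot_m_sandwich x y a b c d :
  rotSU2 m x *m fquat m e a b c d *m rotSU2 m y =
  fquat m e
    (a * cos ((x + y) / 2) - b * sin ((x + y) / 2))
    (a * sin ((x + y) / 2) + b * cos ((x + y) / 2))
    (c * cos ((x - y) / 2) - d * sin ((x - y) / 2))
    (c * sin ((x - y) / 2) + d * cos ((x - y) / 2)).
Proof.
rewrite !rot_m !fquat_mul ?frame_ee ?frame_me // (mulrDl x y) (mulrBl _ x y).
by rewrite cosD cosB sinD sinB; congr fquat; ring.
Qed.

Lemma rot_l_decomposition H beta theta :
  sin (theta / 2) * sin delta = sin (beta / 2) ->
  sin (theta / 2) * cos delta = cos (beta / 2) * sin H ->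
  cos (theta / 2) = cos (beta / 2) * cos H ->
  rotSU2 l beta =
    rotSU2 m (- (H - pi / 2)) *m rotSU2 n theta *m rotSU2 m (- (H + pi / 2)).
Proof.
move=> eq_e eq_m eq_1; rewrite rot_n rot_m_sandwich.
(* Turning by -H takes the (real, m) pair to (cos(beta/2), 0); the quarter turn moves sin(beta/2)
   from e to l. *)
have -> : (- (H - pi / 2) + - (H + pi / 2)) / 2 = - H by field.
have -> : (- (H - pi / 2) - - (H + pi / 2)) / 2 = pi / 2 by field.
rewrite cos_pihalf sin_pihalf cosN sinN eq_e eq_m eq_1 rot_l.
by congr fquat; ring: (sin2cos2 H).
Qed.

End Frame.

(** * Assembling the word *)

Lemma prod_telescope (A : pzRingType) (a b c : nat -> A) (k : nat) :
  \prod_(1 <= j < k.+2) (a j * b j * c j)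
  = a 1%N * (\prod_(1 <= j < k.+1) (b j * (c j * a j.+1))) * b k.+1 * c k.+1.
Proof.
elim: k => [|k IHk]; first by rewrite big_nat1 big_geq // mulr1.
by rewrite big_nat_recr //= IHk [in RHS]big_nat_recr //= !mulrA.
Qed.

(** With the trigonometry done, only additivity in the angle and the conjugation relation enter, so
    the word is computed in an arbitrary ring. *)
Lemma word_of_decomposition (V : zmodType) (A : pzRingType)
    (Rl Rm Rn : V -> A) (delta alpha' beta' gamma' : V) (U : A)
    (k : nat) (betas alphas thetas gammas : nat -> V) :
  Rl 0 = 1 -> {morph Rl : x y / x + y >-> x * y} ->
  {morph Rm : x y / x + y >-> x * y} ->
  Rl delta * Rm alpha' = Rn alpha' * Rl delta ->
  Rl (- delta) * U = Rm alpha' * Rl beta' * Rm gamma' ->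
  (0 < k)%N -> beta' + delta = \sum_(1 <= j < k.+1) betas j ->
  (forall j, (1 <= j <= k)%N ->
     Rl (betas j) = Rm (- alphas j) * Rn (thetas j) * Rm (- gammas j)) ->
  U = Rn alpha' * Rm (- alphas 1%N)
      * (\prod_(1 <= j < k) (Rn (thetas j) * Rm (- gammas j - alphas j.+1)))
      * Rn (thetas k) * Rm (- gammas k + gamma').
Proof.
move=> Rl0 RlD RmD conjE decE k_gt0 sumE stepE.
have -> : U = Rl delta * (Rl (- delta) * U) by rewrite mulrA -RlD subrr Rl0 mul1r.
rewrite decE !mulrA conjE -(mulrA (Rn _)) -RlD addrC sumE.
rewrite (big_morph Rl RlD Rl0) (@eq_big_nat _ _ _ 1%N k.+1 _ _ stepE).
rewrite -!mulrA; congr (_ * _).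
(* From here there are k + 1 factors, hence k junctions where two rotations about m merge. *)
case: k k_gt0 {sumE stepE} => // k _.
under [in RHS]eq_bigr => j _ do rewrite RmD.
rewrite (prod_telescope _ (fun j => Rm (- alphas j))
  (fun j => Rn (thetas j)) (fun j => Rm (- gammas j))).
by rewrite RmD !mulrA.
Qed.

Theorem mainTheorem6 (R : realType) (m n : 'cV[R]_3)
  (hm : sphere2 m) (hn : sphere2 n) (hmn : 0 <= dotp m n < 1) :
  let delta := acos (dotp m n) in
  let l := (norm2 (crossp m n))^-1 *: crossp m n in
  forall (U : 'M[R[i]]_2) (hU : SU2 U)
    (alpha' beta' gamma' : R) (hbeta' : 0 <= beta' <= pi)
    (hdec : rotSU2 l (- delta) *m U =
       rotSU2 m alpha' *m rotSU2 l beta' *m rotSU2 m gamma')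
    (k' : nat) (hk' : (0 < k')%N)
    (betas : nat -> R)
    (hbetas : forall j : nat, (1 <= j <= k')%N -> 0 < betas j <= 2 * delta)
    (hsum : beta' + delta = \sum_(1 <= j < k'.+1) betas j)
    (t : nat -> R),
  let alphas (j : nat) := Hfun (t j) (betas j) delta - pi / 2 in
  let gammas (j : nat) := Hfun (t j) (betas j) delta + pi / 2 in
  let thetas (j : nat) := 2 * asin (sin (betas j / 2) / sin delta) in
  (forall j : nat, (1 <= j <= k')%N ->
     rotSU2 l (betas j) =
       rotSU2 m (- alphas j) *m rotSU2 n (thetas j) *m rotSU2 m (- gammas j))
  /\
  U = rotSU2 n alpha' *m rotSU2 m (- alphas 1%N)
      *m (\prod_(1 <= j < k')
            (rotSU2 n (thetas j) *m rotSU2 m (- gammas j - alphas j.+1)))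
      *m rotSU2 n (thetas k') *m rotSU2 m (- gammas k' + gamma').
Proof.
move=> delta l U _ alpha' beta' gamma' _ hdec k' hk' betas hbetas hsum t
  alphas gammas thetas.
have mm : dotp m m = 1 by apply/sphere2P.
have nn : dotp n n = 1 by apply/sphere2P.
have [mn_ge0 mn_lt1] := andP hmn.
have mn_itv : -1 <= dotp m n <= 1 by apply/andP; split; lra.
have mn : dotp m n = cos delta by rewrite /delta acosK ?in_itv.
have delta_gt0 : 0 < delta by apply: acos_gt0; apply/andP; split; lra.
have delta_le : 0 < delta <= pi / 2.
  (* An obtuse delta would have negative cosine, against the sign of the dot product. *)
  rewrite delta_gt0 leNgt; apply/negP => delta_gt.
  have delta_lepi : delta <= pi by apply: acos_lepi.
  have : cos delta < cos (pi / 2).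
    by rewrite ltr_cos // !in_itv /=; apply/andP; split; lra.
  by rewrite cos_pihalf -mn ltNge mn_ge0.
have pi_gt0 := pi_gt0 R.
have sin_delta : 0 < sin delta.
  by apply: sin_gt0_pi; apply/andP; split=> //; case/andP: delta_le => _ ?; lra.
clearbody delta.
have eq_step j : (1 <= j <= k')%N -> rotSU2 l (betas j) =
    rotSU2 m (- alphas j) *m rotSU2 n (thetas j) *m rotSU2 m (- gammas j).
  move=> /hbetas beta_j.
  have [eq_e eq_m eq_1] := Hfun_trig _ (t j) _ _ sin_delta delta_le beta_j.
  exact: (rot_l_decomposition _ _ _ mm nn mn sin_delta (Hfun (t j) (betas j) delta)
            (betas j) (thetas j)).
have ll : dotp l l = 1 by exact: (dotp_ll _ _ _ mm nn mn sin_delta).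
have l_conj : rotSU2 l delta *m rotSU2 m alpha' = rotSU2 n alpha' *m rotSU2 l delta.
  exact: (rot_l_conj _ _ _ mm nn mn sin_delta).
clearbody l alphas gammas thetas.
split; first by move=> j; apply: eq_step.
apply: (word_of_decomposition R 'M[R[i]]_2 (rotSU2 l) (rotSU2 m) (rotSU2 n)
          delta alpha' beta' gamma' U k' betas alphas thetas gammas).
- exact: rotSU20.
- by move=> x y; apply: rotSU2D.
- by move=> x y; apply: rotSU2D.
- exact: l_conj.
- exact: hdec.
- exact: hk'.
- exact: hsum.
- exact: eq_step.
Qed.
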